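(* For every $n\ge1$, the number of $132$-sortable permutations of length $n$ is $$|\mathrm{Sort}_n(132)|=\sum_{k=0}^{n-1}\binom{n-1}{k}\mathfrak{c}_k,$$ where $\mathfrak{c}_k=\frac{1}{k+1}\binom{2k}{k}$ is the $k$-th Catalan number.
   Context: A permutation contains a pattern $\tau$ if some subsequence has the same relative order as $\tau$; otherwise it avoids $\tau$. The $132$-stack: a permutation $\pi$ is read from left to right and passed through an initially empty stack. At each step, the next input element is pushed onto the stack if the resulting content of the stack, read from top to bottom, avoids $132$; otherwise the top element of the stack is popped and appended to the output. When the input is exhausted, all remaining elements are popped to the output, from top to bottom. The output is denoted $s_{132}(\pi)$. The sequence $s_{132}(\pi)$ is then passed in the same way through a second stack, whose content read from top to bottom must avoid $21$. The permutation $\pi$ is $132$-sortable if the final output is the identity permutation; equivalently (a standard fact on stack sorting), if $s_{132}(\pi)$ avoids $231$. $\mathrm{Sort}_n(132)$ is the set of $132$-sortable permutations of length $n$. *)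

(* Defs.v *)
From mathcomp Require Import all_boot all_fingroup.

Set Implicit Arguments.
Unset Strict Implicit.
Unset Printing Implicit Defensive.

Definition same_relative_order (u v : seq nat) : bool :=
  (size u == size v) &&
  [forall i : 'I_(size u), forall j : 'I_(size u),
     (nth 0 u i < nth 0 u j) == (nth 0 v i < nth 0 v j)].

(* The subsequences of [w] are its masks. *)
Definition contains (tau w : seq nat) : bool :=
  [exists m : (size w).-tuple bool, same_relative_order (mask m w) tau].

Definition avoids (tau w : seq nat) : bool := ~~ contains tau w.

(* A stack is listed from top to bottom.  [push_or_pop tau x st] handles one
   input element [x]: the top of [st] is popped as long as pushing [x] would
   create [tau], then [x] is pushed.  The result is (popped elements in order,
   new stack).  A push onto the empty stack is not tested: for patterns of
   length at least 2 it is always allowed. *)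
Fixpoint push_or_pop (tau : seq nat) (x : nat) (st : seq nat) :
    seq nat * seq nat :=
  if st is y :: st' then
    if avoids tau (x :: st) then ([::], x :: st)
    else let: (out, st'') := push_or_pop tau x st' in (y :: out, st'')
  else ([::], [:: x]).

(* The output produced from stack [st] and remaining input [w]; once the input
   is exhausted, the stack is emptied from top to bottom. *)
Fixpoint stack_run (tau st w : seq nat) : seq nat :=
  if w is x :: w' then
    let: (out, st') := push_or_pop tau x st in out ++ stack_run tau st' w'
  else st.

Definition stack_pass (tau w : seq nat) : seq nat := stack_run tau [::] w.

(* One-line notation, with values in {1, ..., n}. *)
Definition one_line (n : nat) (p : 'S_n) : seq nat :=
  [seq (val (p i)).+1 | i <- enum 'I_n].

Definition sortable132 (n : nat) (p : 'S_n) : bool :=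
  stack_pass [:: 2; 1] (stack_pass [:: 1; 3; 2] (one_line p))
    == one_line (1%g : 'S_n).

Definition Sort132 (n : nat) : {set 'S_n} := [set p | sortable132 p].

Definition catalan (k : nat) : nat := 'C(2 * k, k) %/ k.+1.

(* The division in [catalan] is exact. *)
Lemma catalanE (k : nat) : k.+1 * catalan k = 'C(2 * k, k).
Proof.
rewrite /catalan mulnC divnK //.
have H : k.+1 * 'C(2 * k, k.+1) = k * 'C(2 * k, k).
  by rewrite mul_bin_left mul2n -addnn addnK.
have -> : 'C(2 * k, k) = k.+1 * 'C(2 * k, k) - k.+1 * 'C(2 * k, k.+1).
  by rewrite H -mulnBl subSnn mul1n.
by rewrite -mulnBr dvdn_mulr.
Qed.

(* Main.v *)
Require Import Defs.
From mathcomp Require Import all_boot all_algebra all_fingroup.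
From mathcomp Require Import zify ring.
Set Implicit Arguments.
Unset Strict Implicit.
Unset Printing Implicit Defensive.

Import GRing.Theory.

(** The proof has three parts.

    - Sortability is a pattern condition, [good] (lemma [sortableP]).  The stack
      that must avoid 21 sorts its input exactly when the input avoids 231.
      While a word is read, the content of the stack that must avoid 132 is, from
      top to bottom, a block [C] above the left-to-right minima [M] of the word,
      and [M] increases.  The smallest entry is on top of [M] and leaves after the
      output and all of [C]; so the result avoids 231 exactly when the output
      followed by [C] stays decreasing.  Reading one more
      entry preserves this exactly when no forbidden pattern ends at that entry
      ([stack132_invariant]).

    - Good permutations form a generating tree under the insertion of a new
      maximum.  The maximum can always go in front; it can go after a nonempty
      prefix [x] iff [x] avoids 231 and the entry that follows [x], if any, is
      not larger than all of [x] ([good_insert]).  The available positions are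
      controlled by two numbers [p] and [e] ([label], [label_sites]): a
      permutation with label (p, e) has the children
        (p + e + 1, 0),   (p, e + 1)   and   (i, 1) for i < p,
      and the permutation of length 1 has the label (0, 0).

    - This tree is counted with generating functions in the depth, [x] marking
      one level.  With z = 1 / (1 - x), M = z + x M^2 and r = M / (1 + x M), the
      descendants of a node with label (p, e) have the generating function
        r^p (z + x r^e M^2),
      since this expression satisfies the recursion of the tree
      ([branch_series_rec]).  For the root it is M.  The equation
      M = z + x M^2 says that the coefficients satisfy
        b_0 = 1,   b_(m+1) = 1 + sum_(i <= m) b_i b_(m-i),
      and the binomial transform of the Catalan numbers obeys the same recursion
      ([binCatalan_rec]), by Catalan's convolution and the identity
      sum_i 'C(i, k) 'C(m - i, l) = 'C(m + 1, k + l + 1). *)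

(** * Relative positions and the pattern condition *)

Definition before (s : seq nat) (a b : nat) : bool :=
  (index a s < index b s) && (b \in s).

Lemma before_mem (s : seq nat) (a b : nat) : before s a b -> a \in s /\ b \in s.
Proof.
case/andP=> lt_ab b_s; split=> //; rewrite -index_mem.
by apply: ltn_trans lt_ab _; rewrite index_mem.
Qed.

Lemma before_trans (s : seq nat) : transitive (before s).
Proof.
by move=> b a c /andP[ab _] /andP[bc c_s]; rewrite /before (ltn_trans ab bc).
Qed.

Lemma before_irr (s : seq nat) (a : nat) : before s a a = false.
Proof. by rewrite /before ltnn. Qed.

Lemma before_asym (s : seq nat) (a b : nat) :
  before s a b -> before s b a = false.
Proof.
by move=> ab; apply: contraFF (before_irr s a) => /(before_trans ab).
Qed.

(** The entry [b] being in [s] forces [a] to be there too, since [index] sends an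
    absent entry beyond all positions. *)
Lemma before_catl (s t : seq nat) (a b : nat) :
  b \in s -> before (s ++ t) a b = before s a b.
Proof.
rewrite /before !index_cat mem_cat => b_s; rewrite b_s /=.
case: ifPn => // a_s; rewrite (memNindex a_s) !andbT.
have le_b : index b s <= size s by rewrite index_size.
by rewrite !ltnNge le_b (leq_trans le_b (leq_addr _ _)).
Qed.

Lemma before_cat (s t : seq nat) (a b : nat) : uniq (s ++ t) ->
  before (s ++ t) a b =
  [|| before s a b, (a \in s) && (b \in t) | before t a b].
Proof.
rewrite cat_uniq => /and3P[_ /hasPn st _].
have [b_s|nb_s] := boolP (b \in s).
  rewrite before_catl //; have nb_t : b \notin t by apply/negP => /st; rewrite /= b_s.
  by rewrite /before (negPf nb_t) !andbF !orbF.
rewrite {1 2}/before (negPf nb_s) !andbF /= !index_cat mem_cat (negPf nb_s) /=.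
have [a_s|na_s] /= := boolP (a \in s); last by rewrite ltn_add2l.
have -> : before t a b = (b \in t) && before t a b.
  by rewrite /before andbCA andbb.
case: (b \in t); rewrite ?andbF //= andbT.
by rewrite ltn_addr // index_mem.
Qed.

Lemma before_rcons (s : seq nat) (x a b : nat) : uniq (rcons s x) ->
  before (rcons s x) a b = before s a b || (a \in s) && (b == x).
Proof.
rewrite -cats1 => /before_cat->; rewrite inE; congr (_ || _).
have -> : before [:: x] a b = false; last by rewrite orbF.
rewrite /before /= inE; case: (x =P b) => [->|/eqP]; rewrite ?ltn0 //.
by rewrite eq_sym => /negPf->; rewrite andbF.
Qed.


Lemma before_cons (s : seq nat) (x a b : nat) : x \notin s ->
  before (x :: s) a b = before s a b && (a != x) || (a == x) && (b \in s).
Proof.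
rewrite /before /= inE => nx_s; rewrite ![x == _]eq_sym.
have [->|bx] := eqVneq b x; first by rewrite ltn0 (negPf nx_s) !andbF.
by have [->|ax] := eqVneq a x; rewrite /= ?andbF ?andbT ?orbF ?ltnS.
Qed.

Lemma before_ins (x : seq nat) (N : nat) (y : seq nat) (a b : nat) :
  uniq (x ++ N :: y) -> a != N -> b != N ->
  before (x ++ N :: y) a b = before (x ++ y) a b.
Proof.
move=> uxNy /negPf aN bN.
have [nNy uxy] : N \notin y /\ uniq (x ++ y).
  move: uxNy; rewrite -cat_rcons cat_uniq rcons_uniq cat_uniq => /and3P[/andP[_ ->]].
  move=> /hasPn h ->; rewrite andbT; split; last first.
    by apply/hasPn => z /h; rewrite /= mem_rcons inE negb_or => /andP[].
  by apply/negP => /h; rewrite /= mem_rcons inE eqxx.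
by rewrite !before_cat // before_cons // aN orbF andbT inE (negPf bN).
Qed.

Lemma before_ins_l (x : seq nat) (N : nat) (y : seq nat) (a : nat) :
  uniq (x ++ N :: y) ->
  before (x ++ N :: y) a N = (a \in x).
Proof.
move=> u; rewrite before_cat // mem_head andbT.
have nNx : N \notin x.
  by move: u; rewrite -cat_rcons cat_uniq rcons_uniq => /and3P[/andP[]].
have nNy : N \notin y by move: u; rewrite cat_uniq /= => /and4P[].
rewrite before_cons // {1 2}/before (negPf nNx) (negPf nNy) !andbF /=.
by rewrite orbF.
Qed.

Lemma before_ins_r (x : seq nat) (N : nat) (y : seq nat) (b : nat) :
  uniq (x ++ N :: y) ->
  before (x ++ N :: y) N b = (b \in y).
Proof.
move=> u; rewrite before_cat //.
have nNx : N \notin x.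
  by move: u; rewrite -cat_rcons cat_uniq rcons_uniq => /and3P[/andP[]].
have nNy : N \notin y by move: u; rewrite cat_uniq /= => /and4P[].
have -> : before x N b = false.
  by apply/negP => /before_mem[]; rewrite (negPf nNx).
by rewrite before_cons // eqxx andbF (negPf nNx).
Qed.

Lemma cat_uniq_neq (x y : seq nat) (a b : nat) :
  uniq (x ++ y) -> a \in x -> b \in y -> a != b.
Proof.
rewrite cat_uniq => /and3P[_ /hasPn xy _] a_x /xy /=.
by apply: contraNneq => <-.
Qed.

Lemma before_next (x : seq nat) (N h : nat) (y : seq nat) (b : nat) :
  uniq (x ++ N :: h :: y) -> b \in y -> before (x ++ N :: h :: y) h b.
Proof.
rewrite -cat_rcons => u b_y; rewrite before_cat //; apply/orP; right; apply/orP; right.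
move: u; rewrite cat_uniq => /and3P[_ _ /= /andP[nhy _]].
by rewrite before_cons // eqxx b_y orbT.
Qed.

Definition occ231 (s : seq nat) (b c a : nat) : bool :=
  [&& before s b c, before s c a, a < b & b < c].
Definition avoids231 (s : seq nat) : Prop := forall b c a, ~~ occ231 s b c a.

(** The condition that characterizes sortable words.  The first clause forbids the
    pattern 2314.  The second clause says that the 3 and the 2 of a pattern 132
    (the entries [c] and [x]) must be told apart: either some entry before [c]
    separates them by value, or between them there is some [y] that forms a 231
    with [c] and an entry [m] smaller than [x].  In the stack, each of the two
    makes [c] leave before [x] enters. *)
Definition good (s : seq nat) : Prop :=
  (forall b c a d, occ231 s b c a -> before s a d -> d < c) /\
  (forall a c x, before s a c -> before s c x -> a < x -> x < c ->
     (exists2 m : nat, before s m c & x < m < c) \/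
     (exists m : nat, exists2 y : nat,
         before s m c && before s c y & before s y x && (y < m < x))).


Lemma perm_mid (x : seq nat) (N : nat) (y : seq nat) :
  perm_eq (x ++ N :: y) (N :: x ++ y).
Proof. by rewrite -[N :: y]cat1s perm_catCA. Qed.

Lemma occ231_catl (s t : seq nat) (b c a : nat) :
  occ231 s b c a -> occ231 (s ++ t) b c a.
Proof.
move=> /and3P[bc ca lt]; have [_ c_s] := before_mem bc; have [_ a_s] := before_mem ca.
by rewrite /occ231 !before_catl // bc ca.
Qed.

Lemma occ231_catl_inv (s t : seq nat) (b c a : nat) :
  a \in s -> occ231 (s ++ t) b c a -> occ231 s b c a.
Proof.
move=> a_s /and3P[bc]; rewrite before_catl // => ca lt.
have [c_s _] := before_mem ca; move: bc; rewrite before_catl // => bc.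
by rewrite /occ231 bc ca.
Qed.

Lemma occ231_ins (x : seq nat) (N : nat) (y : seq nat) (b c a : nat) :
  uniq (x ++ N :: y) -> occ231 (x ++ y) b c a -> occ231 (x ++ N :: y) b c a.
Proof.
move=> u /and3P[bc ca lt].
have notN z : z \in x ++ y -> z != N.
  have := perm_uniq (perm_mid x N y).
  by rewrite u /= => /esym/andP[nN _]; apply: contraTneq => ->.
have [b_s c_s] := before_mem bc; have [_ a_s] := before_mem ca.
by rewrite /occ231 !before_ins ?notN // bc ca.
Qed.


(** * The action of a stack *)

(** The pair holds the output so far and the stack.  A left fold replaces the
    recursion of [stack_run], so that invariants can be proved by appending one
    entry to the part that has been read. *)
Definition stack_step (tau : seq nat) (c : seq nat * seq nat) (x : nat) :=
  let: (out, st) := push_or_pop tau x c.2 in (c.1 ++ out, st).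

Definition stack_state (tau w : seq nat) : seq nat * seq nat :=
  foldl (stack_step tau) ([::], [::]) w.

Lemma stack_state_rcons (tau w : seq nat) (x : nat) :
  stack_state tau (rcons w x) = stack_step tau (stack_state tau w) x.
Proof. by rewrite /stack_state foldl_rcons. Qed.

Lemma stack_passE (tau w : seq nat) :
  stack_pass tau w = (stack_state tau w).1 ++ (stack_state tau w).2.
Proof.
rewrite /stack_pass /stack_state -[LHS]cat0s.
have from out st : out ++ stack_run tau st w =
    (foldl (stack_step tau) (out, st) w).1 ++ (foldl (stack_step tau) (out, st) w).2.
  elim: w out st => //= x w IHw out st; rewrite {2 4}/stack_step /=.
  by case: push_or_pop => P st'; rewrite catA IHw.
exact: from.
Qed.

Lemma push_or_pop_cat (tau : seq nat) (x : nat) (st : seq nat) :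
  exists P R, st = P ++ R /\ push_or_pop tau x st = (P, x :: R).
Proof.
elim: st => [|y st [P [R [-> eqP]]]] /=; first by exists [::], [::].
case: ifP => _; first by exists [::], (y :: P ++ R).
by exists (y :: P), R; rewrite eqP.
Qed.

Lemma stack_state_perm (tau w : seq nat) :
  perm_eq ((stack_state tau w).1 ++ (stack_state tau w).2) w.
Proof.
elim/last_ind: w => // w x; rewrite stack_state_rcons /stack_step.
case: (stack_state tau w) => out st /= IHw.
have [P [R [def_st ->]]] := push_or_pop_cat tau x st.
rewrite /= perm_sym perm_rcons perm_sym (perm_trans (perm_mid _ _ _)) // perm_cons.
by rewrite -catA -def_st.
Qed.

Lemma containsP (tau w : seq nat) :
  reflect (exists2 v, subseq v w & same_relative_order v tau) (contains tau w).
Proof.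
apply: (iffP existsP) => [[m sim]|[v /subseqP[m size_m ->] sim]].
  by exists (mask m w); first exact: mask_subseq.
by move/eqP: size_m => size_m; exists (Tuple size_m).
Qed.

Lemma same_relative_orderP (u v : seq nat) :
  reflect (size u = size v /\ forall i j, i < size u -> j < size u ->
             (nth 0 u i < nth 0 u j) = (nth 0 v i < nth 0 v j))
          (same_relative_order u v).
Proof.
apply: (iffP andP) => [[/eqP eq_size /forallP ord]|[eq_size ord]].
  split=> // i j lt_i lt_j.
  by have /forallP/(_ (Ordinal lt_j))/eqP := ord (Ordinal lt_i).
split; first exact/eqP.
by apply/forallP => i; apply/forallP => j; rewrite ord.
Qed.

Lemma contains21P (w : seq nat) :
  reflect (exists a b, subseq [:: a; b] w /\ b < a) (contains [:: 2; 1] w).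
Proof.
apply: (iffP (containsP _ _)) => [[v sub /same_relative_orderP[]]|[a [b [sub lt]]]].
  case: v sub => [|a [|b []]] // sub _ ord; exists a, b; split=> //.
  by have /= -> := ord 1 0 isT isT.
exists [:: a; b] => //; apply/same_relative_orderP; split=> //.
by case=> [|[|//]] [|[|//]] _ _ /=; lia.
Qed.

Lemma contains132P (w : seq nat) :
  reflect (exists a c b, subseq [:: a; c; b] w /\ a < b < c)
          (contains [:: 1; 3; 2] w).
Proof.
apply: (iffP (containsP _ _)) => [[v sub /same_relative_orderP[]]|[a [c [b [sub lt]]]]].
  case: v sub => [|a [|c [|b []]]] // sub _ ord; exists a, c, b; split=> //.
  by have /= -> := ord 0 2 isT isT; have /= -> := ord 2 1 isT isT.
exists [:: a; c; b] => //; apply/same_relative_orderP; split=> //.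
by case=> [|[|[|//]]] [|[|[|//]]] _ _ /=; lia.
Qed.

Lemma occ231_rcons (u : seq nat) (x b c a : nat) : uniq (rcons u x) ->
  occ231 (rcons u x) b c a =
  occ231 u b c a || [&& a == x, before u b c, x < b & b < c].
Proof.
move=> uux; have nx : x \notin u by move: uux; rewrite rcons_uniq => /andP[].
apply/idP/orP => [occ|[/(occ231_catl [:: x])|/and4P[/eqP-> bc lt_xb lt_bc]]].
- have /and4P[bc ca lt_ab lt_bc] := occ.
  have [a_u|na_u] := boolP (a \in u).
    by left; move: occ; rewrite -cats1; apply: occ231_catl_inv.
  move: ca; rewrite before_rcons // => /orP[/before_mem[_]|/andP[c_u /eqP ax]].
    by rewrite (negPf na_u).
  right; move: bc; rewrite -cats1 before_catl // => ->.
  by rewrite -ax eqxx lt_ab.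
- by rewrite cats1.
have [_ c_u] := before_mem bc.
by rewrite /occ231 !before_rcons // bc c_u eqxx lt_xb lt_bc orbT.
Qed.

Lemma avoids231_rcons (u : seq nat) (x : nat) : uniq (rcons u x) ->
  avoids231 (rcons u x) <->
  avoids231 u /\ forall b c, before u b c -> x < b -> b < c -> False.
Proof.
move=> uux; split=> [av|[av last] b c a].
  split=> [b c a|b c bc lt_xb lt_bc].
    by have := av b c a; rewrite occ231_rcons // negb_or => /andP[].
  by have := av b c x; rewrite occ231_rcons // eqxx bc lt_xb lt_bc orbT.
rewrite occ231_rcons // negb_or av /=; apply/negP => /and4P[_ bc lt_xb lt_bc].
exact: last bc lt_xb lt_bc.
Qed.

(** * The stack that must avoid 21 sorts the words that avoid 231 *)
Lemma push21 (x : nat) (st : seq nat) : pairwise ltn st -> x \notin st ->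
  exists P R, [/\ st = P ++ R, push_or_pop [:: 2; 1] x st = (P, x :: R),
                  all (gtn x) P & all (ltn x) R].
Proof.
elim: st => [|y st IHst] /=; first by exists [::], [::].
move=> /andP[/allP y_min st_inc]; rewrite inE negb_or => /andP[neq_xy nx].
case: ifP => [av|/negbFE/contains21P[a [b [sub lt_ba]]]].
  exists [::], (y :: st); split=> //=.
  have lt_xy : x < y.
    rewrite ltn_neqAle neq_xy leqNgt; apply/negP => lt_yx.
    case/contains21P: av; exists x, y; split=> //=.
    by rewrite !eqxx sub0seq.
  rewrite lt_xy; apply/allP => z /y_min /=; exact: ltn_trans.
have [P [R [-> -> P_lt R_gt]]] := IHst st_inc nx.
exists (y :: P), R; split=> //=; rewrite P_lt andbT ltnNge; apply/negP => le_xy.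
have lt_xy : x < y by rewrite ltn_neqAle neq_xy.
have inc : pairwise ltn (x :: y :: st).
  rewrite /= lt_xy st_inc andbT; apply/andP; split; last exact/allP.
  by apply/allP => z /y_min /=; apply: ltn_trans.
by have := subseq_pairwise sub inc; rewrite /= andbT; lia.
Qed.

(** An entry [b] has left the stack exactly when a larger entry has been read after
    it.  Hence an entry that is smaller than an entry already in the output
    completes a pattern 231, and conversely. *)
Lemma stack21_invariant (s : seq nat) : uniq s ->
  let: (out, st) := stack_state [:: 2; 1] s in
  [/\ pairwise ltn st,
      forall b, b \in out <-> exists2 c : nat, before s b c & b < c
    & pairwise ltn (out ++ st) <-> avoids231 s].
Proof.
elim/last_ind: s => [|s x IHs] uux; first by split=> // b; split=> // -[c].
have [nx us] : x \notin s /\ uniq s by apply/andP; rewrite -rcons_uniq.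
have := stack_state_perm [:: 2; 1] s.
rewrite stack_state_rcons /stack_step; move: (IHs us).
case: (stack_state _ s) => out st /=.
move=> [st_inc outP sortedP] perm_s.
have x_new z : z \in out ++ st -> z != x.
  by rewrite (perm_mem perm_s) => z_s; apply: contraNneq nx => <-.
have nx_st : x \notin st.
  apply/negP => x_st; have := x_new x.
  by rewrite mem_cat x_st orbT eqxx => /(_ isT).
have [P [R [def_st -> /allP P_lt /allP R_gt]]] := push21 st_inc nx_st.
have mem_s z : z \in s = [|| z \in out, z \in P | z \in R].
  by rewrite -(perm_mem perm_s) def_st !mem_cat.
have R_inc : pairwise ltn R by move: st_inc; rewrite def_st pairwise_cat => /and3P[].
have P_inc : pairwise ltn P by move: st_inc; rewrite def_st pairwise_cat => /and3P[].
have xR_inc : pairwise ltn (x :: R) by rewrite /= R_inc andbT; apply/allP.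
have out_le b c : before s b c -> b < c -> b \in out.
  by move=> bc lt_bc; apply/outP; exists c.
split=> // [b|].
  split=> [|[c]].
    rewrite mem_cat => /orP[/outP[c bc lt_bc]|b_P].
      by exists c; rewrite // before_rcons // bc.
    exists x; last exact: P_lt.
    by rewrite before_rcons //; apply/orP; right; rewrite mem_s b_P eqxx orbT.
  rewrite before_rcons // mem_cat => /orP[bc lt_bc|/andP[b_s /eqP-> lt_bx]].
    by rewrite (out_le b c).
  move: b_s; rewrite mem_s => /or3P[->|->|/R_gt /=]; rewrite ?orbT //; lia.
rewrite avoids231_rcons // -sortedP def_st; split=> [inc|[inc last]].
  split=> [|b c bc lt_xb lt_bc].
    by apply: subseq_pairwise inc; rewrite -catA subseq_cat2l subseq_cat2l subseq_cons.
  have b_out := out_le b c bc lt_bc.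
  move: inc; rewrite -catA pairwise_cat => /and3P[/allrelP/(_ b x b_out)].
  rewrite mem_cat mem_head orbT => /(_ isT)/ltn_trans/(_ lt_xb).
  by rewrite ltnn.
move: inc; rewrite !pairwise_cat => /and3P[out_st -> /and3P[PR _ _]].
move: out_st; rewrite allrel_catr => /andP[outP_inc outR_inc].
rewrite -/(pairwise ltn (x :: R)) xR_inc outP_inc P_inc !andbT /=.
rewrite allrel_catl !allrel_consr PR outR_inc !andbT; apply/andP; split.
  apply/allP => b b_out /=; have /outP[c bc lt_bc] := b_out.
  have neq := x_new b; rewrite mem_cat b_out in neq.
  rewrite ltn_neqAle neq //= leqNgt; apply/negP => lt_xb.
  exact: last bc lt_xb lt_bc.
by apply/allP => b /P_lt.
Qed.

(** * The stack that must avoid 132 *)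
Lemma pair_dec_inc (D M : seq nat) (c b : nat) :
  pairwise gtn D -> pairwise ltn M -> subseq [:: c; b] (D ++ M) -> b < c ->
  c \in D.
Proof.
move=> + M_inc; elim: D => [|d D IHD] /=.
  move=> _ sub lt_bc; have := subseq_pairwise sub M_inc.
  by rewrite /= andbT ltnNge (ltnW lt_bc).
move=> /andP[_ D_dec]; rewrite inE; case: (eqVneq c d) => //= _ sub lt_bc.
exact: IHD.
Qed.

Lemma avoids132_dec_inc (D M : seq nat) :
  pairwise gtn D -> pairwise ltn M -> ~~ contains [:: 1; 3; 2] (D ++ M).
Proof.
move=> + M_inc; elim: D => [_|d D IHD /= /andP[/allP d_max D_dec]].
  apply/contains132P => -[a [c [b [sub /andP[lt_ab lt_bc]]]]].
  have := subseq_pairwise sub M_inc; rewrite /= !andbT => /andP[_].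
  by rewrite ltnNge (ltnW lt_bc).
apply/contains132P => -[a [c [b [sub /andP[lt_ab lt_bc]]]]]; move: sub => /=.
case: (eqVneq a d) => [ad|_] sub.
  have c_D := pair_dec_inc D_dec M_inc sub lt_bc.
  by have := ltn_trans lt_ab (ltn_trans lt_bc (d_max c c_D)); rewrite ad ltnn.
case/negP: (IHD D_dec); apply/contains132P.
by exists a, c, b; rewrite lt_ab lt_bc.
Qed.

(** The old content has no 132, being decreasing and then increasing, so [x] must
    be the 1.  The top [y] is then the best choice for the 3, as it exceeds every
    entry of the decreasing part. *)
Lemma contains132_push (x y : nat) (D M : seq nat) :
  pairwise gtn (y :: D) -> pairwise ltn M ->
  contains [:: 1; 3; 2] (x :: y :: D ++ M) = has (fun b => x < b < y) (D ++ M).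
Proof.
move=> yD_dec M_inc; have /= /andP[/allP y_max D_dec] := yD_dec.
apply/contains132P/hasP => [[a [c [b [sub /andP[lt_ab lt_bc]]]]]|[b b_DM lt_xby]]; last first.
  by exists x, y, b; split=> //; rewrite /= !eqxx sub1seq.
have := avoids132_dec_inc yD_dec M_inc; move: sub; rewrite /=.
case: (eqVneq a x) => [ax|_] sub; last first.
  by case/contains132P; exists a, c, b; rewrite lt_ab lt_bc.
move=> _; subst a; case: (eqVneq c y) sub => [cy|_] sub.
  by subst c; exists b; rewrite -?sub1seq // lt_ab lt_bc.
have c_D := pair_dec_inc D_dec M_inc sub lt_bc.
have b_DM : b \in D ++ M by apply: (mem_subseq sub); rewrite !inE eqxx orbT.
by exists b => //; rewrite lt_ab (ltn_trans lt_bc (y_max c c_D)).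
Qed.

(** The relation [before u] encodes the vertical order in the stack, as entries
    below were read earlier.  An entry of [C] is popped iff some entry [b] below it
    has a value between [x] and that entry. *)
Lemma push132 (u : seq nat) (x : nat) (C M : seq nat) :
  pairwise gtn C -> pairwise ltn M ->
  pairwise (fun y b => before u b y) (C ++ M) ->
  exists P R, [/\ C = P ++ R,
    push_or_pop [:: 1; 3; 2] x (C ++ M) = (P, x :: R ++ M),
    forall y, y \in P ->
      exists b, [/\ b \in C ++ M, before u b y & x < b < y]
  & forall y b, y \in R -> b \in C ++ M -> before u b y -> x < b -> b < y -> False].
Proof.
move=> + M_inc; elim: C => [_ _|y C IHC yC_dec].
  exists [::], [::]; split=> //=.
  case: M M_inc => //= m M mM_inc; rewrite /avoids.
  suff -> : contains [:: 1; 3; 2] [:: x, m & M] = false by [].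
  by apply/negbTE; apply: (@avoids132_dec_inc [:: x] (m :: M)).
rewrite cat_cons [pairwise _ (y :: _)]/= => /andP[/allP y_last ord].
have /= /andP[/allP y_max C_dec] := yC_dec.
have y_first y' : y' \in C -> before u y y' = false.
  by move=> y'_C; apply/before_asym/y_last; rewrite mem_cat y'_C.
rewrite [push_or_pop _ _ _]/= /avoids contains132_push //.
case: hasP => [[b b_CM lt_xby]|no_cross] /=.
  have [P [R [def_C -> popped kept]]] := IHC C_dec ord.
  exists (y :: P), R; split=> //; first by rewrite def_C.
    move=> y'; rewrite inE => /orP[/eqP->|/popped[b' [b'_CM bb' lt']]].
      by exists b; split=> //; [rewrite inE b_CM orbT|apply: y_last].
    by exists b'; split=> //; rewrite inE b'_CM orbT.
  move=> y' b' y'_R; rewrite inE => /orP[/eqP->|]; last exact: kept.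
  by rewrite y_first // def_C mem_cat y'_R orbT.
exists [::], (y :: C); split=> // y' b; rewrite inE => y'_yC b_yCM bb lt_xb lt_by'.
have neq_by : b != y.
  apply: contraTneq bb => ->; move: y'_yC => /orP[/eqP->|/y_first->//].
  by rewrite before_irr.
case: no_cross; exists b; first by move: b_yCM; rewrite inE (negPf neq_by).
rewrite lt_xb; move: y'_yC => /orP[/eqP<-//|/y_max]; exact: ltn_trans.
Qed.

(** The conditions on an appended entry [x]: it is not the 4 of a 2314, and it is
    not the 2 of an inadmissible 132. *)
Lemma good_rcons (u : seq nat) (x : nat) : uniq (rcons u x) ->
  good (rcons u x) <->
  [/\ good u, forall b c a, occ231 u b c a -> x < c
    & forall a c, before u a c -> a < x -> x < c ->
        (exists2 m : nat, before u m c & x < m < c) \/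
        (exists m a', occ231 u m c a' && (m < x))].
Proof.
move=> uux; have bx a b : b \in u -> before (rcons u x) a b = before u a b.
  by move=> b_u; rewrite -cats1 before_catl.
have bu a b : before u a b -> before (rcons u x) a b.
  by move=> ab; rewrite bx //; case/before_mem: ab.
have nx : x \notin u by move: uux; rewrite rcons_uniq => /andP[].
have bl a : a \in u -> before (rcons u x) a x.
  by move=> a_u; rewrite before_rcons // a_u eqxx orbT.
have bmem a b : before (rcons u x) a b -> a \in u.
  by rewrite before_rcons // => /orP[/before_mem[]|/andP[]].
split=> [[P1 P2]|[[P1 P2] Q1 Q2]].
  split; first split.
  - move=> b c a d occ ad; apply: (P1 b c a d); last exact: bu.
    by rewrite -cats1; apply: occ231_catl.
  - move=> a c z ac cz lt_az lt_zc; have [c_u z_u] := before_mem cz.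
    have [[m mc lt]|[m [y /andP[mc cy] /andP[yz lt]]]] :=
      P2 a c z (bu _ _ ac) (bu _ _ cz) lt_az lt_zc.
      by left; exists m; rewrite -?bx.
    by have y_u := bmem _ _ yz; right; exists m, y; rewrite -!bx // ?mc ?yz.
  - move=> b c a occ; apply: (P1 b c a x); first by rewrite -cats1; apply: occ231_catl.
    by apply: bl; case/and3P: occ => _ /before_mem[].
  - move=> a c ac lt_ax lt_xc; have [_ c_u] := before_mem ac.
    have [[m mc lt]|[m [y /andP[mc cy] /andP[yz /andP[lt_ym lt_mx]]]]] :=
      P2 a c x (bu _ _ ac) (bl _ c_u) lt_ax lt_xc.
      by left; exists m; rewrite -?bx.
    have y_u := bmem _ _ yz; right; exists m, y.
    by rewrite /occ231 -!bx // mc cy lt_ym lt_mx (ltn_trans lt_mx).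
split.
- move=> b c a d occ ad; have a_u := bmem _ _ ad.
  have {}occ : occ231 u b c a.
    by move: occ; rewrite -cats1; apply: occ231_catl_inv.
  move: ad; rewrite before_rcons //.
  by move=> /orP[/(P1 b c a d occ)|/andP[_ /eqP->]] //; apply: Q1 occ.
- move=> a c z ac cz lt_az lt_zc; have c_u := bmem _ _ cz.
  rewrite bx // in ac.
  move: cz; rewrite before_rcons // => /orP[cz|/andP[_ /eqP zx]].
    have [[m mc lt]|[m [y /andP[mc cy] /andP[yz lt]]]] := P2 a c z ac cz lt_az lt_zc.
      by left; exists m; rewrite ?bu.
    by right; exists m, y; rewrite !bu.
  subst z.
  have [[m mc lt]|[m [y /andP[/and4P[mc cy lt_ym _] lt_mx]]]] :=
    Q2 a c ac lt_az lt_zc.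
    by left; exists m; rewrite ?bu.
  have [_ y_u] := before_mem cy.
  by right; exists m, y; rewrite ?(bu _ _ mc) ?(bu _ _ cy) ?(bl _ y_u) ?lt_ym.
Qed.

(** The stack is [C] above the left-to-right minima [m :: M], with [m] the current
    minimum of [u].  The last clause says which entries have been output: those
    that are the 3 of some 231 in [u]. *)
Definition good_state (u out st : seq nat) : Prop :=
  exists C m M,
    [/\ st = C ++ m :: M, pairwise gtn (out ++ C), pairwise ltn (m :: M)
      & [/\ forall z, z \in u -> m <= z,
            forall c a, c \in m :: M -> before u a c -> c < a,
            pairwise (fun y b => before u b y) st
          & forall c, c \in out <-> exists b a, occ231 u b c a]].

(** A word [u] that is not good already has a 231 in the output followed by the
    stack.  This pattern persists: a step pops a top segment of the stack, which
    does not change the output followed by the stack, and inserts the new entry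
    right after that segment. *)
Lemma stack132_invariant (u : seq nat) : uniq u -> u != [::] ->
  let: (out, st) := stack_state [:: 1; 3; 2] u in
  good u /\ good_state u out st \/
  ~ good u /\ exists b c a, occ231 (out ++ st) b c a.
Proof.
elim/last_ind: u => // u x IHu uux _.
have [nx uu] : x \notin u /\ uniq u by apply/andP; rewrite -rcons_uniq.
have mono a b : before u a b -> before (rcons u x) a b.
  by move=> ab; rewrite before_rcons // ab.
have blast a : a \in u -> before (rcons u x) a x.
  by move=> a_u; rewrite before_rcons // a_u eqxx orbT.
have bx a b : b \in u -> before (rcons u x) a b = before u a b.
  by move=> b_u; rewrite -cats1 before_catl.
have [u0|u_n0] := eqVneq u [::].
  have none a b : before (rcons u x) a b = false.
    by rewrite before_rcons // u0 /before !andbF.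
  rewrite u0 /=; left; split.
    split=> [b c a d /and3P[]|a c z]; rewrite -[[:: x]]/(rcons [::] x) -u0 !none //.
  exists [::], x, [::]; split=> //; split=> //= [z|c a _|c].
  - by rewrite inE => /eqP->.
  - by rewrite -[[:: x]]/(rcons [::] x) -u0 none.
  split=> // -[b [a /and3P[]]].
  by rewrite -[[:: x]]/(rcons [::] x) -u0 !none.
have := stack_state_perm [:: 1; 3; 2] (rcons u x).
have := stack_state_perm [:: 1; 3; 2] u.
rewrite stack_state_rcons /stack_step; move: (IHu uu u_n0).
case: (stack_state _ u) => out st /=.
case=> [[good_u]|[bad_u [b [c [a occ]]]]]; last first.
  move=> perm_u.
  have [P [R [def_st ->]]] := push_or_pop_cat [:: 1; 3; 2] x st => /= perm_ux.
  right; split; first by case/good_rcons.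
  exists b, c, a; apply: occ231_ins; last by rewrite -catA -def_st.
  by rewrite (perm_uniq perm_ux).
move=> [C [m [M [-> outC_dec mM_inc [m_min mM_lr ord outP]]]]] perm_u.
have C_dec : pairwise gtn C by move: outC_dec; rewrite pairwise_cat => /and3P[].
have [P [R [def_C -> popped kept]]] := push132 x C_dec mM_inc ord.
rewrite /= => perm_ux.
have uout : uniq (out ++ C ++ m :: M) by rewrite (perm_uniq perm_u).
have mem_u z : z \in u = [|| z \in out, z \in C | z \in m :: M].
  by rewrite -(perm_mem perm_u) !mem_cat.
have x_new z : z \in u -> z != x by apply: contraTneq => ->.
have m_u : m \in u by rewrite mem_u mem_head !orbT.
have m_below y : y \in C -> before u m y.
  move: ord; rewrite pairwise_cat => /and3P[/allrelP h _ _] y_C.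
  by apply: h; rewrite ?mem_head.
have m_lt y : y \in C -> m < y.
  move=> y_C; rewrite ltn_neqAle m_min ?mem_u ?y_C ?orbT // andbT.
  by apply: contraTneq (m_below y y_C) => ->; rewrite before_irr.
have not_min b c : before u b c -> b < c -> c \in m :: M -> False.
  move=> bc lt_bc c_mM; have := mM_lr c b c_mM bc.
  by rewrite ltnNge (ltnW lt_bc).
have out_gt b c : b \in out -> c \in C -> c < b.
  by move: outC_dec; rewrite pairwise_cat => /and3P[/allrelP h _ _]; apply: h.
have ord_x st' : subseq st' (C ++ m :: M) ->
    pairwise (fun y b => before (rcons u x) b y) (x :: st').
  move=> sub /=; apply/andP; split.
    apply/allP => z /(mem_subseq sub) z_st; apply: blast.
    by rewrite mem_u -mem_cat z_st orbT.
  by apply: sub_pairwise (subseq_pairwise sub ord) => y b; apply: mono.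
have lr_x c a : c \in m :: M -> before (rcons u x) a c -> c < a.
  move=> c_mM; rewrite bx ?mem_u ?c_mM ?orbT //; exact: mM_lr.
(* A new minimum [x] expels all of [C], since each entry of [C] above [m] would
   form a 132 with [x] and [m]. *)
have [lt_xm|le_mx] := ltnP x m.
  have R0 : R = [::].
    case: R def_C kept {perm_ux} => // y R def_C kept.
    have y_C : y \in C by rewrite def_C mem_cat mem_head orbT.
    exfalso; apply: (kept y m) => //; first exact: mem_head.
    - by rewrite mem_cat mem_head orbT.
    - exact: m_below.
    - exact: m_lt.
  move: def_C; rewrite R0 cats0 => def_P; left; split.
    apply/good_rcons => //; split=> //.
      move=> b c a /and3P[/before_mem[_ c_u] _ _].
      exact: leq_trans lt_xm (m_min c c_u).
    move=> a c /before_mem[/m_min le_ma _] lt_ax.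
    by have := leq_ltn_trans le_ma (ltn_trans lt_ax lt_xm); rewrite ltnn.
  exists [::], x, (m :: M); split=> //; first by rewrite cats0 -def_P.
    move: mM_inc => /= /andP[m_lt_M ->]; rewrite lt_xm m_lt_M !andbT /=.
    by apply/allP => z /(allP m_lt_M) /=; apply: ltn_trans.
  split.
  - move=> z; rewrite mem_rcons inE => /orP[/eqP->//|/m_min]; exact/leq_trans/ltnW.
  - move=> c a; rewrite inE => /orP[/eqP->|]; last exact: lr_x.
    rewrite before_rcons // => /orP[/before_mem[_]|/andP[/m_min le_ma _]].
      by rewrite (negPf nx).
    exact: leq_trans lt_xm le_ma.
  - by apply: ord_x; apply: suffix_subseq.
  move=> c; rewrite -def_P mem_cat; split.
    move=> /orP[/outP[b [a occ]]|c_C].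
      by exists b, a; rewrite occ231_rcons // occ.
    by exists m, x; rewrite occ231_rcons // eqxx m_below // lt_xm m_lt ?orbT.
  move=> [b [a]]; rewrite occ231_rcons // => /orP[occ|/and4P[_ bc _ lt_bc]].
    by apply/orP; left; apply/outP; exists b, a.
  have [_] := before_mem bc; rewrite mem_u => /or3P[->|->|/(not_min b c bc lt_bc)] //.
  by rewrite orbT.
have lt_mx : m < x by rewrite ltn_neqAle x_new.
have P_gt y : y \in P -> x < y.
  by case/popped => b [_ _ /andP[lt_xb]]; apply: ltn_trans.
have not_cross b y : y \in R -> before u b y -> x < b -> b < y -> False.
  move=> y_R bb lt_xb lt_by; have [b_u _] := before_mem bb.
  have y_C : y \in C by rewrite def_C mem_cat y_R orbT.
  move: b_u; rewrite mem_u -mem_cat => /orP[b_out|b_st]; last exact: kept bb lt_xb lt_by.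
  by have := ltn_trans lt_by (out_gt b y b_out y_C); rewrite ltnn.
(* The new entry sits between the output [out ++ P] and the kept part [R]; since
   [P] lies above [x], the word [out ++ P ++ x :: R] is decreasing iff [Q]. *)
pose Q := (forall y, y \in R -> y < x) /\ (forall c, c \in out -> x < c).
have goodQ : good (rcons u x) <-> Q.
  split=> [/(good_rcons uux)[_ Q1 Q2]|[R_lt out_lt]];
    [split|apply/(good_rcons uux); split=> //].
  - move=> y y_R; have y_C : y \in C by rewrite def_C mem_cat y_R orbT.
    have y_u : y \in u by rewrite mem_u y_C orbT.
    rewrite ltn_neqAle x_new //= leqNgt; apply/negP => lt_xy.
    have [|[b bb /andP[lt_xb lt_by]]|[b [a /andP[occ lt_bx]]]] := Q2 m y _ lt_mx lt_xy.
    + exact: m_below.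
    + exact: not_cross bb lt_xb lt_by.
    have y_out : y \in out by apply/outP; exists b, a.
    by have := out_gt y y y_out y_C; rewrite ltnn.
  - by move=> c /outP[b [a]]; apply: Q1.
  - by move=> b c a occ; apply: out_lt; apply/outP; exists b, a.
  move=> a c ac lt_ax lt_xc; have [_] := before_mem ac.
  rewrite mem_u def_C mem_cat -orbA => /or4P[c_out|c_P|c_R|c_mM].
  - have /outP[b [a' occ]] := c_out; have /and4P[bc _ _ lt_bc] := occ.
    have [b_u _] := before_mem bc.
    have [lt_bx|lt_xb|eq_bx] := ltngtP b x; last by rewrite -eq_bx b_u in nx.
      by right; exists b, a'; rewrite occ.
    by left; exists b; rewrite // lt_xb.
  - by have [b [_ bc lt]] := popped c c_P; left; exists b.
  - by have := ltn_trans lt_xc (R_lt c c_R); rewrite ltnn.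
  by case: (not_min a c ac (ltn_trans lt_ax lt_xc) c_mM).
have [/andP[/allP R_lt /allP out_lt]|nQ] := boolP (all (gtn x) R && all (ltn x) out).
  left; split; first exact/goodQ.
  exists (x :: R), m, M; split=> //.
    move: outC_dec; rewrite def_C catA !pairwise_cat /= => /and3P[outP_R -> ->].
    rewrite allrel_consr outP_R !andbT; apply/andP; split; last exact/allP.
    by apply/allP => z; rewrite mem_cat => /orP[/out_lt|/P_gt].
  split.
  - by move=> z; rewrite mem_rcons inE => /orP[/eqP->|/m_min].
  - exact: lr_x.
  - by apply: ord_x; rewrite def_C -catA suffix_subseq.
  move=> c; rewrite mem_cat; split.
    move=> /orP[/outP[b [a occ]]|/popped[b [_ bc lt]]].
      by exists b, a; rewrite occ231_rcons // occ.
    by exists b, x; rewrite occ231_rcons // eqxx bc lt orbT.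
  move=> [b [a]]; rewrite occ231_rcons // => /orP[occ|/and4P[_ bc lt_xb lt_bc]].
    by apply/orP; left; apply/outP; exists b, a.
  have [_] := before_mem bc.
  rewrite mem_u def_C mem_cat -orbA => /or4P[->|->|c_R|c_mM]; rewrite ?orbT //.
    by case: (not_cross b c c_R bc lt_xb lt_bc).
  by case: (not_min b c bc lt_bc c_mM).
right; split.
  by case/goodQ => R_lt out_lt; case/negP: nQ; apply/andP; split; apply/allP.
have u_ux : uniq ((out ++ P) ++ x :: R ++ m :: M) by rewrite (perm_uniq perm_ux).
have xm : before ((out ++ P) ++ x :: R ++ m :: M) x m.
  by rewrite before_ins_r // mem_cat mem_head orbT.
(* If [Q] fails, [x] and the offending entry form an ascent that lies before [m]. *)
have below_m z : z \in (out ++ P) ++ x :: R ->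
    before ((out ++ P) ++ x :: R ++ m :: M) z m.
  move=> z_in; move: u_ux; rewrite -cat_cons catA => u_ux.
  by rewrite before_cat // z_in mem_head orbT.
case/nandP: nQ => /allPn[z z_in /=]; rewrite -leqNgt => le_zx.
  have z_u : z \in u by rewrite mem_u def_C mem_cat z_in !orbT.
  exists x, z, m; rewrite /occ231 before_ins_r // mem_cat z_in below_m.
    by rewrite lt_mx ltn_neqAle eq_sym x_new.
  by rewrite mem_cat inE z_in !orbT.
have z_u : z \in u by rewrite mem_u z_in.
exists z, x, m; rewrite /occ231 before_ins_l // mem_cat z_in xm.
rewrite !ltn_neqAle m_min // x_new // le_zx !andbT /=.
by rewrite eq_sym (cat_uniq_neq uout) // mem_cat mem_head orbT.
Qed.

Lemma pairwise_before (r : rel nat) (s : seq nat) (a b : nat) :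
  uniq s -> pairwise r s -> before s a b -> r a b.
Proof.
elim: s => //= x s IHs /andP[nx us] /andP[/allP x_r s_r].
rewrite before_cons // => /orP[/andP[ab _]|/andP[/eqP-> /x_r]] //; exact: IHs.
Qed.

(** For a good word the result is decreasing and then increasing, hence without a
    231. *)
Lemma avoids231_stack132 (s : seq nat) : uniq s ->
  avoids231 (stack_pass [:: 1; 3; 2] s) <-> good s.
Proof.
move=> us; have [s0|s_n0] := eqVneq s [::].
  by rewrite s0; split=> // _ b c a; rewrite /occ231 /before !andbF.
have := stack132_invariant us s_n0; have := stack_state_perm [:: 1; 3; 2] s.
rewrite stack_passE; case: (stack_state _ s) => out st /= perm_s.
case=> [[good_s [C [m [M [def_st D_dec M_inc _]]]]]|[bad_s [b [c [a occ]]]]]; last first.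
  by split=> // /(_ b c a); rewrite occ.
split=> // _ b c a; apply/negP => /and4P[bc ca lt_ab lt_bc].
have uDM : uniq ((out ++ C) ++ m :: M) by rewrite -catA -def_st (perm_uniq perm_s).
have [uD uM] : uniq (out ++ C) /\ uniq (m :: M).
  by move: uDM; rewrite cat_uniq => /and3P[].
rewrite def_st catA in bc ca.
have c_M : c \in m :: M.
  move: bc; rewrite before_cat // => /or3P[/(pairwise_before uD D_dec) /=|/andP[]|] //.
    by rewrite ltnNge (ltnW lt_bc).
  by case/before_mem.
have lt_ac := ltn_trans lt_ab lt_bc.
move: ca; rewrite before_cat // => /or3P[/before_mem[c_D _]|/andP[c_D _]|].
- by have := cat_uniq_neq uDM c_D c_M; rewrite eqxx.
- by have := cat_uniq_neq uDM c_D c_M; rewrite eqxx.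
by move/(pairwise_before uM M_inc); rewrite /= ltnNge (ltnW lt_ac).
Qed.

Definition sortable_seq (s : seq nat) : bool :=
  sorted ltn (stack_pass [:: 2; 1] (stack_pass [:: 1; 3; 2] s)).

Lemma stack_pass_perm (tau s : seq nat) : perm_eq (stack_pass tau s) s.
Proof. by rewrite stack_passE stack_state_perm. Qed.

Lemma sortableP (s : seq nat) : uniq s -> reflect (good s) (sortable_seq s).
Proof.
move=> us; set t := stack_pass [:: 1; 3; 2] s.
have ut : uniq t by rewrite (perm_uniq (stack_pass_perm _ _)).
have := stack21_invariant ut; rewrite /sortable_seq -/t (sorted_pairwise ltn_trans).
rewrite [stack_pass _ t]stack_passE; case: (stack_state _ t) => out st /= [_ _ sorted_av].
by apply: (iffP idP) => [/sorted_av/(avoids231_stack132 us)|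
  /(avoids231_stack132 us)/sorted_av].
Qed.

(** * The binomial transform of the Catalan numbers *)
Lemma catalan_rec k : k.+2 * catalan k.+1 = (4 * k + 2) * catalan k.
Proof.
have central : k.+1 * 'C(2 * k.+1, k.+1) = (4 * k + 2) * 'C(2 * k, k).
  have e1 : k.+1 * 'C(2 * k.+1, k.+1) = (2 * k).+2 * 'C((2 * k).+1, k).
    by rewrite mulnS add2n -mul_bin_diag.
  have e2 : k.+1 * 'C((2 * k).+1, k) = (2 * k).+1 * 'C(2 * k, k).
    have := mul_bin_down (2 * k).+1 k.
    by have -> : (2 * k).+1 - k = k.+1 by lia.
  apply/eqP; rewrite -(eqn_pmul2l (ltn0Sn k)) e1 mulnCA e2; apply/eqP; lia.
apply/eqP; rewrite -(eqn_pmul2l (ltn0Sn k)) catalanE central -catalanE.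
by rewrite mulnCA.
Qed.

(** Induction on [n].  By the symmetry exchanging [i] and [n - i], weighting the
    terms by [i.+1] multiplies the sum by [n.+2] / 2; on the other hand
    [catalan_rec] turns the weighted sum for [n.+1] into the sums for [n]. *)
Lemma catalan_conv n :
  \sum_(i < n.+1) catalan i * catalan (n - i) = catalan n.+1.
Proof.
pose T m := \sum_(i < m.+1) catalan i * catalan (m - i).
have weighted m : 2 * (\sum_(i < m.+1) i.+1 * (catalan i * catalan (m - i)))
    = m.+2 * T m.
  rewrite mul2n -addnn {1}(reindex_inj rev_ord_inj) -big_split big_distrr /=.
  apply: eq_bigr => i _; rewrite subSS subKn; last by rewrite -ltnS.
  have lt_i := ltn_ord i; rewrite (mulnC (catalan (m - i))) -mulnDl.
  by congr (_ * _); lia.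
rewrite -/(T n); elim: n => [|n IHn]; first by rewrite /T big_ord1.
have := weighted n.+1; rewrite big_ord_recl /= subn0 mul1n.
under eq_bigr => i _ do
  rewrite /bump add1n subSS mulnA catalan_rec -mulnA mulnDl -mulnA.
rewrite big_split -!big_distrr /= -/(T n).
have := weighted n; under [X in 2 * X]eq_bigr => i _ do rewrite mulSn.
rewrite big_split /= -/(T n) (_ : catalan 0 = 1) // mul1n IHn => w1 w2.
apply/eqP; rewrite -(eqn_pmul2l (ltn0Sn n.+2)) catalan_rec -w2.
apply/eqP; lia.
Qed.

(** Both sides count the subsets of size k + l + 1 of a set of size m + 1; the left
    side sorts them by the position [i] of their (k + 1)-st element. *)
Lemma bin_conv m k l :
  \sum_(i < m.+1) 'C(i, k) * 'C(m - i, l) = 'C(m.+1, (k + l).+1).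
Proof.
elim: m k l => [|m IHm] k l.
  by rewrite big_ord1 /= !bin0n; case: k l => [|k] [|l].
case: l => [|l].
  rewrite addn0 big_ord_recr /= subnn bin0 muln1 [RHS]binS.
  congr (_ + _); rewrite -{2}[k]addn0 -IHm.
  by apply: eq_bigr => i _; rewrite !bin0.
rewrite big_ord_recr /= subnn bin0n muln0 addn0.
under eq_bigr => i _ do rewrite (subSn (leq_ord i)) binS mulnDr.
by rewrite big_split /= !IHm addnS -binS.
Qed.

Definition binCatalan (m : nat) : nat := \sum_(k < m.+1) 'C(m, k) * catalan k.

Lemma binCatalan_widen m n : m < n ->
  binCatalan m = \sum_(k < n) 'C(m, k) * catalan k.
Proof.
move=> lt_mn; rewrite /binCatalan.
rewrite (big_ord_widen n (fun k => 'C(m, k) * catalan k) lt_mn) big_mkcond /=.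
by apply: eq_bigr => k _; rewrite ltnS; case: leqP => // /bin_small->.
Qed.

(** Expand the product, sum over [i] first with [bin_conv], and collect the pairs
    with the same sum by [catalan_conv]. *)
Lemma binCatalan_rec m :
  binCatalan m.+1 = 1 + \sum_(i < m.+1) binCatalan i * binCatalan (m - i).
Proof.
rewrite {1}/binCatalan big_ord_recl bin0 mul1n; congr (_ + _).
pose t k l := catalan k * catalan l.
transitivity (\sum_(k < m.+1) \sum_(l < m.+1)
    'C(m.+1, (k + l).+1) * t k l); last first.
  under [LHS]eq_bigr => k _ do under eq_bigr => l _ do
    rewrite -bin_conv big_distrl /=.
  under [LHS]eq_bigr => k _ do rewrite exchange_big /=.
  rewrite exchange_big /=; apply: eq_bigr => i _.
  rewrite (@binCatalan_widen i m.+1) //.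
  rewrite (@binCatalan_widen (m - i) m.+1) ?ltnS ?leq_subr //.
  rewrite big_distrl /=; apply: eq_bigr => k _.
  rewrite big_distrr /=; apply: eq_bigr => l _.
  by rewrite /t; ring.
transitivity (\sum_(j < m.+1) \sum_(k < m.+1) \sum_(l < m.+1 | k + l == j)
    'C(m.+1, (k + l).+1) * t k l).
  apply: eq_bigr => j _; rewrite lift0 -catalan_conv big_distrr /=.
  rewrite -(big_mkord xpredT
    (fun i => 'C(m.+1, j.+1) * (catalan i * catalan (j - i)))).
  rewrite (big_nat_widen _ _ m.+1) //= big_mkord big_mkcond; apply: eq_bigr => k _.
  rewrite ltnS; case: leqP => [le_kj|lt_jk].
    have lt_jkm : j - k < m.+1 by apply: leq_ltn_trans (leq_subr _ _) _.
    rewrite (big_pred1 (Ordinal lt_jkm)) /= ?subnKC // => l.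
    by rewrite /= -val_eqE /=; apply/eqP/eqP; lia.
  by rewrite big1 // => l /eqP; lia.
rewrite exchange_big /=; apply: eq_bigr => k _.
rewrite (exchange_big_dep xpredT) //=; apply: eq_bigr => l _.
case: (ltnP (k + l) m.+1) => [lt_m|le_m].
  by rewrite (big_pred1 (Ordinal lt_m)).
rewrite bin_small // big1 // => j /eqP e.
Qed.

Local Open Scope ring_scope.

(** * Counting the generating tree *)
Definition branch_series (R : comNzRingType) (x z M r : R) (p e : nat) : R :=
  r ^+ p * (z + x * r ^+ e * M ^+ 2).

(** The hypotheses are the equations for [z], [M] and [r] modulo [y], which will be
    a high power of the variable [x].  In the proof the difference of the two sides
    is written as a combination of these equations; [d'] collects the multiples of
    [y]. *)
Lemma branch_series_rec (R : comNzRingType) (x y z M r d1 d2 : R) :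
    (1 - x) * z = 1 - y -> M = z + x * M ^+ 2 + y * d1 ->
    r * (1 + x * M) = M + y * d2 ->
  forall p e, exists d,
    branch_series x z M r p e =
      1 + x * (branch_series x z M r (p + e).+1 0 + branch_series x z M r p e.+1
               + \sum_(i < p) branch_series x z M r i 1) + y * d.
Proof.
move=> eq_z eq_M eq_r p e; rewrite /branch_series.
elim: p => [|p [d IHp]].
  exists (- 1 - x * r ^+ e * M * d2 + x * r ^+ e.+1 * d1).
  rewrite big_ord0 add0n expr0 !exprS; set s := r ^+ e.
  apply/eqP; rewrite -subr_eq0; apply/eqP.
  transitivity (((1 - x) * z - (1 - y))
    + x * r * s * (M - (z + x * M ^+ 2 + y * d1))
    - x * s * M * (r * (1 + x * M) - (M + y * d2))); first by ring.
  by rewrite eq_z -eq_M eq_r; ring.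
pose d' := x * (r - 1) * r ^+ e * (r * d1 - M * d2) - r + d1 + d2 - x * M * d2.
exists (d + r ^+ p * d').
rewrite big_ord_recr /=; move: IHp; set S := \sum_(i < p) _.
rewrite addSn !(exprS r) !(exprD r) /d' expr0; set s := r ^+ p; set t := r ^+ e => IHp.
apply/eqP; rewrite -subr_eq0; apply/eqP.
pose D1 := s * (z + x * t * M ^+ 2).
pose D2 := 1 + x * (r * (s * t) * (z + x * 1 * M ^+ 2)
                    + s * (z + x * (r * t) * M ^+ 2) + S) + y * d.
transitivity (D1 - D2 + s * (((1 - x) * z - (1 - y)) * r
    + (M - (z + x * M ^+ 2 + y * d1)) * (x * (r - 1) * r * t + 1)
    + (r * (1 + x * M) - (M + y * d2)) * (1 - x * M - x * t * (r - 1) * M))).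
  by rewrite /D1 /D2; ring.
by rewrite eq_z -eq_M eq_r !subrr !mul0r !addr0 mulr0 addr0 /D1 /D2 IHp subrr.
Qed.

(** The number of nodes at depth [k] below a node with label (p, e). *)
Fixpoint tree_count (k p e : nat) : nat :=
  if k is k'.+1 then
    (tree_count k' (p + e).+1 0 + tree_count k' p e.+1
     + \sum_(i < p) tree_count k' i 1)%N
  else 1.


(** Power series are represented by polynomials modulo a power of the variable. *)
Lemma poly_modXn (R : comNzRingType) (K : nat) (p q : {poly R}) :
  (forall i, (i < K)%N -> p`_i = q`_i) -> exists d, p = q + 'X^K * d.
Proof.
move=> eq_pq; exists (drop_poly K (p - q)).
apply/eqP; rewrite addrC -subr_eq -{1}(poly_take_drop K (p - q)) mulrC.
rewrite -subr_eq0 addrK; apply/eqP/polyP => i.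
by rewrite coef_take_poly coef0 coefB; case: ifP => // /eq_pq ->; rewrite subrr.
Qed.

Lemma tree_count_binCatalan k : tree_count k 0 0 = binCatalan k.
Proof.
pose K := k.+1.
pose M : {poly int} := \poly_(i < K) (binCatalan i)%:Z.
pose z : {poly int} := \poly_(i < K) 1.
pose r := M * \sum_(i < K) (- ('X * M)) ^+ i.
have eq_z : (1 - 'X) * z = 1 - 'X^K.
  rewrite /z poly_def -[RHS]opprB subrX1 -mulNr opprB.
  by congr (_ * _); apply: eq_bigr => i _; rewrite scale1r.
have [d1 eq_M] : exists d1, M = z + 'X * M ^+ 2 + 'X^K * d1.
  apply: poly_modXn => i lt_iK.
  rewrite !coefD coefXM !coef_poly lt_iK; case: i => [|i] /= in lt_iK *.
    by rewrite addr0 /binCatalan big_ord1.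
  rewrite binCatalan_rec PoszD coefM; congr (_ + _).
  rewrite -[LHS]natz natr_sum; apply: eq_bigr => j _.
  have lt_jK : (j < K)%N by apply: leq_trans (ltn_ord j) (ltnW _).
  rewrite !coef_poly lt_jK (leq_ltn_trans (leq_subr j i) (ltnW lt_iK)).
  by rewrite natz PoszM.
(* The factor of [M] in [r] is the truncated geometric series of - 'X * M. *)
have [d2 eq_r] : exists d2, r * (1 + 'X * M) = M + 'X^K * d2.
  exists (- M * (- M) ^+ K); rewrite /r -mulrA.
  have -> : (\sum_(i < K) (- ('X * M)) ^+ i) * (1 + 'X * M) = 1 - (- ('X * M)) ^+ K.
    by rewrite mulrC -[RHS]opprB subrX1 -[RHS]mulNr opprB opprK.
  by rewrite -mulrN exprMn; ring.
have coef_tree n p e : (n < K)%N ->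
    (branch_series 'X z M r p e)`_n = (tree_count n p e)%:Z.
  elim: n p e => [|n IHn] p e lt_nK;
    have [d ->] := branch_series_rec eq_z eq_M eq_r p e.
    by rewrite !coefD coefXM coefXnM lt_nK coef1.
  rewrite !coefD coefXM coefXnM lt_nK coef1 !coefD /= add0r addr0.
  rewrite !IHn ?(ltnW lt_nK) // coef_sum !PoszD.
  rewrite -[(\sum_(_ < _) _)%N%:Z]natz natr_sum.
  by congr (_ + _); apply: eq_bigr => i _; rewrite IHn ?(ltnW lt_nK) ?natz.
apply/eqP; rewrite -eqz_nat -coef_tree //; apply/eqP.
transitivity (M`_k); last by rewrite coef_poly ltnSn.
rewrite /branch_series [in RHS]eq_M !expr0 mul1r mulr1.
by rewrite [RHS]coefD coefXnM ltnSn addr0.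
Qed.

Local Close Scope ring_scope.

(** * Inserting a new maximum *)
Definition insert_at (N j : nat) (s : seq nat) : seq nat := take j s ++ N :: drop j s.

(** For the condition on the entry [h] after the maximum: if [h] exceeds all of
    [x], then an entry of [x], the maximum and [h] form a 132 whose 3 and 2 are
    adjacent and not separated by any value before.  If some [m] in [x] exceeds
    [h], then every later entry is either below [m], and [m] separates it from the
    maximum, or above [m], and [h] plays the role of [y] in [good]. *)
Lemma good_insert (x : seq nat) (N : nat) (y : seq nat) :
  uniq (x ++ N :: y) -> all (gtn N) (x ++ y) ->
  good (x ++ N :: y) <->
  good (x ++ y) /\
    (x = [::] \/ avoids231 x /\
       (y = [::] \/ exists2 m : nat, m \in x & head 0 y < m)).
Proof.
set s := x ++ y; set t := x ++ N :: y => ut /allP ltN.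
have bst a b : before s a b -> before t a b.
  move=> ab; have [/ltN/= aN /ltN/= bN] := before_mem ab.
  by rewrite before_ins // neq_ltn ?aN ?bN.
have bts a b : before t a b -> a != N -> b != N -> before s a b.
  by move=> + aN bN; rewrite before_ins.
have btl a : before t a N -> a \in x by rewrite before_ins_l.
have btr b : before t N b -> b \in y by rewrite before_ins_r.
have memN a : a \in t -> a != N -> a < N.
  by move=> a_t aN; apply: ltN; move: a_t; rewrite !mem_cat inE (negPf aN).
split=> [[P1 P2]|[[P1 P2] site]].
  split; first split.
  - move=> b c a d /and4P[bc ca lt_ab lt_bc] ad.
    by apply: (P1 b c a d); rewrite /occ231 ?bst ?lt_ab ?lt_bc.
  - move=> a c z ac cz lt_az lt_zc.
    have cN : c < N by case/before_mem: ac => _ /ltN.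
    have [[m mc /andP[zm lt_mc]]|[m [w]]] :=
      P2 a c z (bst _ _ ac) (bst _ _ cz) lt_az lt_zc.
    + left; exists m; rewrite ?zm //.
      by apply: bts mc _ _; lia.
    + move=> /andP[mc cw] /andP[wz /andP[wm mz]]; right; exists m, w.
        by rewrite !bts //; lia.
      by rewrite wm mz bts //; lia.
  case: x @s @t ut ltN bst bts btl btr memN P1 P2 => [|x0 x]; first by left.
  set x' := x0 :: x => s t ut ltN bst bts btl btr memN P1 P2; right; split.
    move=> b c a; apply/negP => /and4P[bc ca lt_ab lt_bc].
    have a_x : a \in x' by case/before_mem: ca.
    have c_x : c \in x' by case/before_mem: bc.
    have occ : occ231 t b c a by rewrite /occ231 /t !before_catl // bc ca lt_ab.
    have /(P1 b c a N occ) : before t a N by rewrite before_ins_l.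
    by have /= := ltN c; rewrite mem_cat c_x => /(_ isT); lia.
  case: y @s @t ut ltN bst bts btl btr memN P1 P2 => [|h y]; first by left.
  set y' := h :: y => s t ut ltN bst bts btl btr memN P1 P2; right.
  have hy : h \in y' by rewrite mem_head.
  have lt_hN : h < N by apply: ltN; rewrite mem_cat hy orbT.
  have [lt_hx0|le_x0h] := ltnP h x0; first by exists x0; rewrite // mem_head.
  have neq : x0 != h.
    by apply: (cat_uniq_neq ut); rewrite ?mem_head // inE hy orbT.
  have lt_x0h : x0 < h by rewrite ltn_neqAle neq.
  have [||//|//|[m]|[m [w]]] := P2 x0 N h.
  - by rewrite before_ins_l // mem_head.
  - by rewrite before_ins_r.
  - by rewrite before_ins_l // => mx /andP[]; exists m.
  - move=> /andP[_ /btr w_y] /andP[wh /andP[lt_wm lt_mh]].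
    have neq_w : w != h by lia.
    have lt_hw : before t h w.
      by apply: before_next; move: w_y; rewrite // inE (negPf neq_w).
    by have := before_asym lt_hw; rewrite wh.
split.
- move=> b c a d /and4P[bc ca lt_ab lt_bc] ad.
  have [b_t c_t] := before_mem bc; have [_ a_t] := before_mem ca.
  have [_ d_t] := before_mem ad.
  have bN : b != N.
    apply/eqP=> bN; have [cN|cN] := eqVneq c N; first by lia.
    by have := memN c c_t cN; lia.
  have lt_bN := memN b b_t bN; have aN : a != N by lia.
  have [cN|cN] := eqVneq c N.
    subst c; have [dN|/(memN d d_t)//] := eqVneq d N.
    by subst d; have := before_asym ca; rewrite ad.
  have [dN|dN] := eqVneq d N.
    exfalso; subst d.
    have a_x := btl a ad; have c_x := btl c (before_trans ca ad).
    case: site => [x0|[/(_ b c a)/negP[]]]; first by rewrite x0 in a_x.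
    rewrite /occ231 -(before_catl (N :: y) b c_x) -(before_catl (N :: y) c a_x).
    by rewrite -/t bc ca lt_ab lt_bc.
  by apply: (P1 b c a d); rewrite /occ231 ?bts ?lt_ab ?lt_bc.
- move=> a c z ac cz lt_az lt_zc.
  have [a_t c_t] := before_mem ac; have [_ z_t] := before_mem cz.
  have zN : z != N.
    apply/eqP=> zN; have [cN|cN] := eqVneq c N; first by lia.
    by have := memN c c_t cN; lia.
  have lt_zN := memN z z_t zN; have aN : a != N by lia.
  have [cN|cN] := eqVneq c N; last first.
    have [||//|//|[m mc lt_zm]|[m [w /andP[mc cw] /andP[wz lt_wm]]]] := P2 a c z;
      try exact: bts.
    - by left; exists m; rewrite ?bst.
    - by right; exists m, w; rewrite !bst.
  subst c; have a_x := btl a ac; have z_y := btr z cz.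
  case: site => [x0|[_ [y0|[m m_x]]]]; first by rewrite x0 in a_x.
    by rewrite y0 in z_y.
  have lt_mN : m < N by apply: ltN; rewrite mem_cat m_x.
  have mN : before t m N by rewrite before_ins_l.
  case: y @s @t ut ltN bst bts btl btr memN P1 P2 ac cz {a_t c_t z_t} mN z_y => // h y s t.
  move=> ut ltN bst bts btl btr memN P1 P2 ac cz mN z_y /= lt_hm.
  have [lt_zm|le_mz] := ltnP z m; first by left; exists m; rewrite ?lt_zm.
  have neq_mz : m != z.
    by apply: (cat_uniq_neq ut) => //; rewrite inE z_y orbT.
  right; exists m, h; first by rewrite mN before_ins_r // mem_head.
  have lt_mz : m < z by rewrite ltn_neqAle neq_mz.
  rewrite lt_hm lt_mz !andbT.
  have neq_hz : h != z by lia.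
  by apply: before_next; move: z_y; rewrite // inE eq_sym (negPf neq_hz).
Qed.

Lemma avoids231_prefix (s t : seq nat) : avoids231 (s ++ t) -> avoids231 s.
Proof. by move=> av b c a; apply: contra (av b c a); apply: occ231_catl. Qed.

Lemma avoids231_cons_max (N : nat) (s : seq nat) :
  uniq (N :: s) -> all (gtn N) s -> avoids231 s -> avoids231 (N :: s).
Proof.
move=> /= /andP[nN us] /allP ltN av b c a; apply/negP => /and4P[bc ca lt_ab lt_bc].
move: bc ca; rewrite !before_cons //.
have [bN|bN] := eqVneq b N; rewrite /= ?andbT ?andbF ?orbF /=.
  by move=> /ltN /=; lia.
have [cN|cN] := eqVneq c N; rewrite /= ?andbT ?andbF ?orbF /=.
  by rewrite cN => /before_mem[_]; rewrite (negPf nN).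
by move=> bc ca; have /negP[] := av b c a; rewrite /occ231 bc ca lt_ab.
Qed.

Lemma has231_rcons (s : seq nat) (x : nat) :
  uniq (rcons s x) -> avoids231 s -> ~ avoids231 (rcons s x) ->
  exists2 m : nat, m \in s & x < m.
Proof.
move=> u av nav; have [/hasP[m]|/hasPn le] := boolP (has (ltn x) s); first by exists m.
case: nav => b c a; apply/negP => occ; have /and4P[bc ca lt_ab lt_bc] := occ.
have [b_s _] := before_mem bc; have [c_s a_s] := before_mem ca.
move: a_s; rewrite mem_rcons inE => /orP[/eqP ax|a_s]; last first.
  by move: occ; rewrite -cats1 => /(occ231_catl_inv a_s); apply/negP.
move: b_s; rewrite mem_rcons inE => /orP[/eqP bx|/le /=]; lia.
Qed.

Lemma avoids231_rcons_max (N : nat) (s : seq nat) :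
  uniq (rcons s N) -> all (gtn N) s -> avoids231 s -> avoids231 (rcons s N).
Proof.
move=> u /allP ltN av b c a; apply/negP => occ.
have /and4P[bc ca lt_ab lt_bc] := occ.
have [c_s a_s] := before_mem ca.
move: a_s; rewrite mem_rcons inE => /orP[/eqP aN|a_s]; last first.
  by move: occ; rewrite -cats1 => /(occ231_catl_inv a_s); apply/negP.
by move: c_s; rewrite mem_rcons inE => /orP[/eqP cN|/ltN /=]; lia.
Qed.

(** The word starts with a prefix [u] whose maximum is its first entry, followed by
    an increasing run [w] of new left-to-right maxima; [u ++ w] is the longest
    prefix without 231.  A maximum can be inserted inside [u], at its end only if
    [w] is empty, never inside [w], and at the end of [w].  So [p] counts the inner
    positions of [u], one less than its size; the front of the word and the end of
    [w] are always available. *)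
Variant label (s : seq nat) (p e : nat) : Prop :=
  Label u w v of s = u ++ w ++ v & size u = p.+1 & size w = e
    & all (leq^~ (head 0 u)) u & sorted ltn (head 0 u :: w)
    & avoids231 (u ++ w)
    & (v = [::] \/ ~ avoids231 (rcons (u ++ w) (head 0 v))).

Lemma insert_at_uniq (N j : nat) (s : seq nat) :
  N \notin s -> uniq s -> uniq (insert_at N j s).
Proof.
move=> nN us; by rewrite /insert_at (perm_uniq (perm_mid _ _ _)) cat_take_drop /= nN.
Qed.

Lemma sortable_ins (N j : nat) (s : seq nat) :
  uniq s -> all (gtn N) s -> good s ->
  reflect (j = 0 \/ s = [::] \/ avoids231 (take j s) /\
             (size s <= j \/ exists2 m : nat, m \in take j s & nth 0 s j < m))
          (sortable_seq (insert_at N j s)).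
Proof.
move=> us ltN gs.
have nN : N \notin s by apply/negP => /(allP ltN) /=; rewrite ltnn.
apply: (iffP (sortableP (insert_at_uniq j nN us))); rewrite /insert_at.
  move/(good_insert (insert_at_uniq j nN us)); rewrite cat_take_drop => /(_ ltN)[_ [|[av h]]].
    by case: j s {us ltN gs nN} => [|j] [|y s] //; [left|left|right; left].
  right; right; split=> //; case: h => [d0|[m m_t]].
    by left; rewrite -subn_eq0 -size_drop d0.
  by rewrite -nth0 nth_drop addn0 => lt; right; exists m.
move=> h; apply/(good_insert (insert_at_uniq j nN us)); rewrite cat_take_drop //; split=> //.
case: h => [->|[->|[av h]]]; [by left; rewrite take0|by left|right; split=> //].
case: h => [le|[m m_t lt]]; first by left; apply: drop_oversize.
by right; exists m; rewrite // -nth0 nth_drop addn0.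
Qed.

Lemma label_sites (N p e : nat) (s : seq nat) :
  uniq s -> all (gtn N) s -> good s -> label s p e ->
  [seq j <- iota 0 (size s).+1 | sortable_seq (insert_at N j s)]
    = rcons (iota 0 p.+1) (p.+1 + e).
Proof.
move=> us ltN gs [u w v def_s size_u size_w u_max w_inc av uwv].
have siteP j := sortable_ins j us ltN gs.
have u_gt0 : 0 < size u by rewrite size_u.
have headu : head 0 u \in u by rewrite -nth0 mem_nth.
have size_s : (size s).+1 = p.+1 + (e + (size v).+1).
  by rewrite def_s !size_cat size_u size_w !addnS.
rewrite size_s iotaD filter_cat add0n iotaD filter_cat -cats1; congr (_ ++ _).
  apply/all_filterP/allP => j.
  rewrite mem_iota add0n => /andP[_ lt_jp]; apply/siteP.
  case: j lt_jp => [|j lt_jp]; [by left|right; right].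
  have take_s : take j.+1 s = take j.+1 u by rewrite def_s take_cat size_u lt_jp.
  rewrite take_s; split.
    by apply: (@avoids231_prefix _ (drop j.+1 u ++ w)); rewrite catA cat_take_drop.
  right; exists (head 0 u).
    by case: (u) u_gt0 => //= x u' _; rewrite mem_head.
  rewrite def_s nth_cat size_u lt_jp ltn_neqAle.
  have lt_ju : j.+1 < size u by rewrite size_u.
  rewrite (allP u_max) ?mem_nth // andbT -nth0 nth_uniq //.
  by move: us; rewrite def_s cat_uniq => /andP[].
rewrite -[RHS]cat0s; congr (_ ++ _).
  apply/eqP; rewrite -[_ == _]negbK -has_filter; apply/hasPn => j.
  rewrite mem_iota => /andP[le_pj lt_j]; apply/siteP.
  have def_j : j = size u + (j - p.+1) by rewrite size_u subnKC.
  set i := j - p.+1 in def_j; have lt_ie : i < e by rewrite /i; lia.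
  case=> [|[|]]; first by lia.
    by move/(congr1 size); rewrite def_s size_cat size_u.
  case=> _ []; first by move: size_s; rewrite leqNgt; lia.
  have wi_max m : m \in u ++ take i w -> m < nth 0 w i.
    move: w_inc; rewrite /= (path_sortedE ltn_trans) => /andP[/allP w_big w_inc].
    rewrite mem_cat => /orP[m_u|].
      apply: leq_ltn_trans (allP u_max m m_u) _.
      by apply: w_big; rewrite mem_nth ?size_w.
    case/(nthP 0) => k; rewrite size_take size_w lt_ie => lt_ki <-.
    rewrite nth_take //; apply: (sorted_ltn_nth ltn_trans) => //.
    by rewrite inE size_w (ltn_trans lt_ki).
    by rewrite inE size_w.
  case=> m; rewrite def_s def_j take_cat ltnNge leq_addr /= addKn.
  rewrite take_cat size_w lt_ie => /wi_max.
  rewrite nth_cat [_ < size u]ltnNge leq_addr /= addKn nth_cat size_w lt_ie.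
  by lia.
rewrite [iota _ _.+1]/= [filter _ _]/=.
have take_uw : take (p.+1 + e) s = u ++ w.
  by rewrite def_s catA take_size_cat // size_cat size_u size_w.
have drop_uw : drop (p.+1 + e) s = v.
  by rewrite def_s catA drop_size_cat // size_cat size_u size_w.
have nth_uw : nth 0 s (p.+1 + e) = head 0 v.
  by rewrite -nth0 -drop_uw nth_drop addn0.
have -> : sortable_seq (insert_at N (p.+1 + e) s).
  apply/siteP; right; right; rewrite take_uw nth_uw; split=> //.
  have [v0|v_n0] := eqVneq v [::].
    by left; rewrite def_s v0 cats0 size_cat size_u size_w.
  right; case: uwv => [v0|nav]; first by rewrite v0 in v_n0.
  apply: has231_rcons nav => //.
  move: us; rewrite def_s catA; case: (v) v_n0 => // h v' _.
  by rewrite -cat_rcons cat_uniq => /andP[].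
congr (_ :: _); apply/eqP; rewrite -[_ == _]negbK -has_filter; apply/hasPn => j.
rewrite mem_iota => /andP[le_pj lt_j]; apply/siteP; case=> [|[|]]; first by lia.
  by move/(congr1 size); rewrite def_s size_cat size_u.
case=> av_j _; case: uwv => [v0|]; first by move: lt_j; rewrite v0 /=; lia.
case; move: av_j; rewrite def_s catA take_cat size_cat size_u size_w.
rewrite ltnNge (ltnW le_pj) /=.
have -> : j - (p.+1 + e) = (j - (p.+1 + e).+1).+1 by lia.
case: (v) lt_j => [|h v'] /= lt_j; first by lia.
by rewrite -cat_rcons; apply: avoids231_prefix.
Qed.

(** In front, the maximum absorbs [w]: no entry of [u ++ w] is a left-to-right
    maximum any more, and the maximum cannot take part in a 231 from there. *)
Lemma label_front (N p e : nat) (s : seq nat) :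
  uniq (N :: s) -> all (gtn N) s -> label s p e ->
  label (insert_at N 0 s) (p + e).+1 0.
Proof.
move=> uNs ltN [u w v def_s size_u size_w _ _ av uwv].
have perm_s : N :: s = (N :: u ++ w) ++ v by rewrite def_s /= catA.
exists (N :: u ++ w) [::] v => //.
- by rewrite /insert_at take0 drop0.
- by rewrite /= size_cat size_u size_w addSn.
- rewrite /= leqnn /=; apply/allP => z z_uw; apply: ltnW.
  by apply: (allP ltN); rewrite def_s catA mem_cat z_uw.
- rewrite cats0; move: uNs; rewrite perm_s cat_uniq => /andP[uuw _].
  apply: avoids231_cons_max => //; apply/allP => z z_uw.
  by apply: (allP ltN); rewrite def_s catA mem_cat z_uw.
case: v uwv def_s perm_s => [|h v] uwv def_s perm_s; first by left.
right; rewrite cats0 => av_N; case: uwv => // -[] b c a.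
have u_h : uniq (N :: rcons (u ++ w) h).
  by move: uNs; rewrite perm_s -cat_rcons cat_uniq => /andP[].
by apply: contra (av_N b c a) => /(@occ231_ins [::] N _ b c a u_h).
Qed.

(** Inside [u], the first entry, the maximum and the next entry of [u] form a 231,
    which ends the prefix without 231 right after the maximum. *)
Lemma label_middle (N p e i : nat) (s : seq nat) :
  uniq s -> all (gtn N) s -> i < p -> label s p e ->
  label (insert_at N i.+1 s) i 1.
Proof.
move=> us ltN lt_ip [u w v def_s size_u size_w u_max _ av _].
have lt_iu : i.+1 < size u by rewrite size_u.
have u_sub z : z \in u -> z < N.
  by move=> z_u; apply: (allP ltN); rewrite def_s mem_cat z_u.
have take_sub z : z \in take i.+1 u -> z \in u by apply: mem_take.
have head_u : head 0 (take i.+1 u) = head 0 u by case: (u) lt_iu.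
have headu : head 0 u \in take i.+1 u.
  by case: (u) lt_iu => //= x u' _; rewrite mem_head.
have def_t : insert_at N i.+1 s = rcons (take i.+1 u) N ++ (drop i.+1 u ++ w ++ v).
  by rewrite /insert_at def_s take_cat drop_cat lt_iu cat_rcons.
have ut : uniq (insert_at N i.+1 s).
  by apply: insert_at_uniq => //; apply/negP => /(allP ltN) /=; rewrite ltnn.
exists (take i.+1 u) [:: N] (drop i.+1 u ++ w ++ v) => //.
- by rewrite def_t cat_rcons.
- by rewrite size_take lt_iu.
- by rewrite head_u; apply/allP => z /take_sub; apply: (allP u_max).
- by rewrite /= head_u andbT u_sub // take_sub.
- rewrite cats1; apply: avoids231_rcons_max.
  + by move: ut; rewrite def_t cat_uniq => /andP[].
  + by apply/allP => z /take_sub/u_sub.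
  by apply: (@avoids231_prefix _ (drop i.+1 u ++ w)); rewrite catA cat_take_drop.
right; rewrite (drop_nth 0 lt_iu) /= cats1.
set h := nth 0 u i.+1 => /(_ (head 0 u) N h)/negP[].
have h_u : h \in u by rewrite mem_nth.
have uuh : uniq (rcons (take i.+1 u) N ++ [:: h]).
  move: ut; rewrite def_t (drop_nth 0 lt_iu) -/h !cat_uniq /= => /and3P[-> + _].
  by rewrite !negb_or => /andP[-> _].
have lt_h : h < head 0 u.
  rewrite ltn_neqAle (allP u_max) // andbT eq_sym.
  by apply: cat_uniq_neq uuh _ _; rewrite ?mem_head // mem_rcons inE headu orbT.
rewrite /occ231 -cats1 !before_cat // -cats1.
rewrite (@before_ins_l _ _ [::]) ?headu ?lt_h ?u_sub ?take_sub //=.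
  by rewrite mem_cat !inE !eqxx !orbT.
by move: uuh; rewrite -cats1 cat_uniq => /andP[].
Qed.

Lemma label_last (N p e : nat) (s : seq nat) :
  uniq (N :: s) -> all (gtn N) s -> label s p e ->
  label (insert_at N (p.+1 + e) s) p e.+1.
Proof.
move=> /= /andP[nNs us] ltN [u w v def_s size_u size_w u_max w_inc av uwv].
have ut := insert_at_uniq (p.+1 + e) nNs us.
have def_t : insert_at N (p.+1 + e) s = u ++ rcons w N ++ v.
  rewrite /insert_at def_s !catA -size_u -size_w -size_cat take_size_cat //.
  by rewrite drop_size_cat // -!catA cat_rcons.
have uw_sub z : z \in u ++ w -> z < N.
  by move=> z_uw; apply: (allP ltN); rewrite def_s catA mem_cat z_uw.
exists u (rcons w N) v => //.
- by rewrite size_rcons size_w.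
- move: w_inc; rewrite /= rcons_path => -> /=; apply: uw_sub.
  have := mem_last (head 0 u) w; rewrite inE mem_cat => /orP[/eqP->|->].
    by case: (u) size_u => //= x u' _; rewrite mem_head.
  by rewrite orbT.
- rewrite -rcons_cat; apply: avoids231_rcons_max => //.
    by move: ut; rewrite def_t catA -rcons_cat cat_uniq => /andP[].
  by apply/allP => z /uw_sub.
case: v uwv def_s def_t => [|h v] uwv def_s def_t; first by left.
right; case: uwv => // nav av'; apply: nav => b c a.
apply: contra (av' b c a); rewrite -rcons_cat -[rcons (u ++ w) h]cats1.
have -> : rcons (rcons (u ++ w) N) h = (u ++ w) ++ N :: [:: h].
  by rewrite -!cats1 -catA.
apply: occ231_ins; move: ut; rewrite def_t.
by rewrite catA -rcons_cat cat_rcons -[h :: v]cat1s -cat_cons catA cat_uniq => /andP[].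
Qed.

Fixpoint descendants (k : nat) (s : seq nat) : nat :=
  if k is k'.+1 then
    \sum_(j <- [seq j <- iota 0 (size s).+1
                 | sortable_seq (insert_at (size s).+1 j s)])
       descendants k' (insert_at (size s).+1 j s)
  else 1.

(** The positions found in [label_sites] give one child each: the front of the word
    [label_front], position [i.+1] in the prefix [label_middle], the end of [w]
    [label_last]. *)
Lemma descendants_tree_count (k p e : nat) (s : seq nat) :
  perm_eq s (iota 1 (size s)) -> good s -> label s p e ->
  descendants k s = tree_count k p e.
Proof.
elim: k p e s => [//|k IHk] p e s perm_s gs lab_s.
set N := (size s).+1.
change (\sum_(j <- [seq j <- iota 0 N | sortable_seq (insert_at N j s)])
          descendants k (insert_at N j s) = tree_count k.+1 p e).
have ltN : all (gtn N) s.
  by rewrite (perm_all _ perm_s); apply/allP => z; rewrite mem_iota add1n => /andP[].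
have us : uniq s by rewrite (perm_uniq perm_s) iota_uniq.
have nN : N \notin s by apply/negP => /(allP ltN) /=; rewrite ltnn.
have uNs : uniq (N :: s) by rewrite /= nN.
have sites := label_sites us ltN gs lab_s.
have step j p' e' : j \in rcons (iota 0 p.+1) (p.+1 + e) ->
    label (insert_at N j s) p' e' ->
    descendants k (insert_at N j s) = tree_count k p' e'.
  rewrite -sites mem_filter => /andP[sort_j _]; apply: IHk.
    have perm_j : perm_eq (insert_at N j s) (rcons s N).
      rewrite perm_sym perm_rcons perm_sym.
      by rewrite (perm_trans (perm_mid _ _ _)) ?cat_take_drop.
    rewrite (perm_trans perm_j) // (perm_size perm_j) size_rcons -cats1.
    by rewrite -[X in iota 1 X]addn1 iotaD add1n perm_cat2r.
  by apply/sortableP => //; apply: insert_at_uniq.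
rewrite sites big_rcons /= big_cons (iotaDl 1 0) big_map.
rewrite (step _ _ _ _ (label_last uNs ltN lab_s)) ?mem_rcons ?mem_head //.
rewrite (step _ _ _ _ (label_front uNs ltN lab_s)); last first.
  by rewrite mem_rcons inE mem_iota orbT.
rewrite -[iota 0 p]val_enum_ord big_map big_enum /=.
rewrite (eq_bigr (fun i : 'I_p => tree_count k i 1)) => [|i _].
  by rewrite addnAC; congr (_ + _); apply: eq_bigl.
apply: step; last exact: label_middle lab_s.
by rewrite mem_rcons inE mem_iota /= add1n ltnS ltn_ord orbT.
Qed.

(** * Enumerating the sortable permutations *)

(** The sortable permutations of length [k.+1], level by level in the tree. *)
Fixpoint sortable_perms (k : nat) : seq (seq nat) :=
  if k is k'.+1 then
    [seq insert_at k.+1 j s | s <- sortable_perms k',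
       j <- [seq j <- iota 0 k.+1 | sortable_seq (insert_at k.+1 j s)]]
  else [:: [:: 1]].

Lemma sortable_perms_size (k : nat) (s : seq nat) :
  s \in sortable_perms k -> size s = k.+1.
Proof.
elim: k s => [|k IHk] s; first by rewrite inE => /eqP->.
case/allpairsPdep => t [j [/IHk size_t _ ->]].
by rewrite (perm_size (perm_mid _ _ _)) cat_take_drop /= size_t.
Qed.

Lemma size_sortable_perms (k : nat) : size (sortable_perms k) = descendants k [:: 1].
Proof.
have shift m :
    size (sortable_perms (m + k)) = \sum_(s <- sortable_perms m) descendants k s.
  elim: k m => [|k IHk] m; first by rewrite addn0 sum1_size.
  rewrite addnS -addSn IHk /= big_allpairs_dep; apply: eq_big_seq => s s_m.
  by rewrite (sortable_perms_size s_m).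
by rewrite -[k]add0n shift big_seq1.
Qed.

Lemma good_seq1 (x : nat) : good [:: x].
Proof.
have none a b : before [:: x] a b = false.
  by rewrite -[[:: x]]/(rcons [::] x) before_rcons // /before !andbF.
by split=> [b c a d|a c y]; rewrite /occ231 !none.
Qed.

Lemma label_seq1 (x : nat) : label [:: x] 0 0.
Proof.
exists [:: x] [::] [::] => //; first by rewrite /= leqnn.
  move=> b c a; apply/negP => /and4P[/before_mem[+ _] /before_mem[+ _]].
  by rewrite !inE => /eqP-> /eqP->; rewrite ltnn.
by left.
Qed.

(** Removing the maximum of a good word leaves a good word, by [good_insert], so the
    tree reaches every sortable permutation. *)
Lemma mem_sortable_perms (k : nat) (s : seq nat) :
  (s \in sortable_perms k) = perm_eq s (iota 1 k.+1) && sortable_seq s.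
Proof.
elim: k s => [|k IHk] s.
  rewrite inE; apply/eqP/andP => [->|[perm_s _]].
    by split=> //; apply/sortableP/good_seq1.
  exact: perm_small_eq perm_s.
have perm_N : perm_eq (iota 1 k.+2) (k.+2 :: iota 1 k.+1).
  by rewrite -[X in iota 1 X]addn1 iotaD add1n perm_catC.
apply/allpairsPdep/andP => [[t [j []]]|[perm_s sort_s]].
  rewrite IHk mem_filter => /andP[perm_t _] /andP[sort_s _] ->; split=> //.
  rewrite (perm_trans (perm_mid _ _ _)) // cat_take_drop perm_sym.
  by rewrite (perm_trans perm_N) // perm_cons perm_sym.
have us : uniq s by rewrite (perm_uniq perm_s) iota_uniq.
have N_s : k.+2 \in s by rewrite (perm_mem perm_s) mem_iota add1n !ltnS leqnn.
case/splitPr: N_s perm_s sort_s us => x y perm_s sort_s us.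
have perm_t : perm_eq (x ++ y) (iota 1 k.+1).
  rewrite -(perm_cons k.+2) -(permPl (perm_mid _ _ _)).
  by rewrite (perm_trans perm_s).
have ltN : all (gtn k.+2) (x ++ y).
  by rewrite (perm_all _ perm_t); apply/allP => z; rewrite mem_iota add1n => /andP[].
have ut : uniq (x ++ y) by rewrite (perm_uniq perm_t) iota_uniq.
have ins_t : insert_at k.+2 (size x) (x ++ y) = x ++ k.+2 :: y.
  by rewrite /insert_at take_size_cat // drop_size_cat.
exists (x ++ y), (size x); split=> //.
  rewrite IHk perm_t /=; apply/sortableP => //.
  by have [/(_ (sortableP us sort_s))[]] := good_insert us ltN.
rewrite mem_filter ins_t sort_s mem_iota /= add0n ltnS.
by have /perm_size := perm_t; rewrite size_cat size_iota => <-; apply: leq_addr.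
Qed.

Lemma uniq_sortable_perms (k : nat) : uniq (sortable_perms k).
Proof.
elim: k => [//|k IHk]; apply: allpairs_uniq_dep => // [s _|].
  by rewrite filter_uniq ?iota_uniq.
have split_ins t j : t \in sortable_perms k -> j <= k.+1 ->
    index k.+2 (insert_at k.+2 j t) = j /\
    take j (insert_at k.+2 j t) ++ drop j.+1 (insert_at k.+2 j t) = t.
  move=> t_k le_j; have size_t := sortable_perms_size t_k.
  move: t_k; rewrite mem_sortable_perms => /andP[/perm_mem mem_t _].
  have nN : k.+2 \notin take j t.
    by apply/negP => /mem_take; rewrite mem_t mem_iota add1n ltnn andbF.
  have size_j : size (take j t) = j by rewrite size_takel ?size_t.
  rewrite /insert_at index_cat (negPf nN) /= eqxx addn0 size_j take_size_cat //.
  by rewrite drop_cat size_j ltnNge leqnSn /= subSnn /= drop0 cat_take_drop.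
move=> p q /allpairsPdep[t [j [t_k j_in ->]]].
move=> /allpairsPdep[t' [j' [t'_k j'_in ->]]] /= eq_ins.
have le_j i u :
    i \in [seq i <- iota 0 k.+2 | sortable_seq (insert_at k.+2 i u)] ->
    i <= k.+1.
  by rewrite mem_filter mem_iota add0n ltnS => /and3P[].
have [e1 e2] := split_ins t j t_k (le_j _ _ j_in).
have [e1' e2'] := split_ins t' j' t'_k (le_j _ _ j'_in).
have eq_j : j = j' by rewrite -e1 eq_ins.
by rewrite -e2 eq_ins eq_j e2'.
Qed.

Lemma one_line_perm (n : nat) (p : 'S_n) : perm_eq (one_line p) (iota 1 n).
Proof.
have -> : iota 1 n = [seq (val i).+1 | i <- enum 'I_n].
  by rewrite -[1]addn0 iotaDl -val_enum_ord -map_comp.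
rewrite /one_line (map_comp (fun i : 'I_n => (val i).+1) p).
apply/perm_map/uniq_perm => [||i]; last 1 first.
- rewrite mem_enum inE; apply/mapP.
  by exists ((p^-1)%g i); rewrite ?mem_enum ?permKV.
- by rewrite (map_inj_uniq perm_inj) enum_uniq.
exact: enum_uniq.
Qed.

Lemma one_line_inj (n : nat) : injective (@one_line n).
Proof.
move=> p q /eq_in_map eq_pq; apply/permP => i; apply/val_inj/eq_add_S.
by apply: eq_pq; rewrite mem_enum.
Qed.

Lemma one_line_surj (n : nat) (s : seq nat) :
  perm_eq s (iota 1 n) -> exists p : 'S_n, one_line p = s.
Proof.
move=> perm_s; have size_s : size s = n by rewrite (perm_size perm_s) size_iota.
have us : uniq s by rewrite (perm_uniq perm_s) iota_uniq.
have s_bound (i : 'I_n) : 0 < nth 0 s i <= n.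
  have : nth 0 s i \in s by rewrite mem_nth ?size_s.
  by rewrite (perm_mem perm_s) mem_iota add1n ltnS.
have lt_pred (i : 'I_n) : (nth 0 s i).-1 < n by have := s_bound i; lia.
pose f i := Ordinal (lt_pred i).
have f_inj : injective f.
  move=> i j /(congr1 val)/= eq_ij; apply/val_inj/eqP.
  rewrite -(nth_uniq 0 _ _ us) ?size_s //=; apply/eqP.
  have /andP[i_gt0 _] := s_bound i; have /andP[j_gt0 _] := s_bound j.
  by rewrite -(prednK i_gt0) -(prednK j_gt0) eq_ij.
exists (perm f_inj); apply: (@eq_from_nth _ 0) => [|i].
  by rewrite size_map size_enum_ord size_s.
rewrite size_map size_enum_ord => lt_in.
rewrite (nth_map (Ordinal lt_in)) ?size_enum_ord // permE /=.
by rewrite nth_enum_ord // prednK //; case/andP: (s_bound (Ordinal lt_in)).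
Qed.

(** The result of both passes is a rearrangement of 1, ..., n, so it is the identity
    iff it is increasing. *)
Lemma sortable132E (n : nat) (p : 'S_n) :
  sortable132 p = sortable_seq (one_line p).
Proof.
rewrite /sortable132 /sortable_seq; set t := stack_pass [:: 2; 1] _.
have perm_t : perm_eq t (iota 1 n).
  apply: perm_trans (stack_pass_perm _ _) _.
  by apply: perm_trans (stack_pass_perm _ _) (one_line_perm p).
have -> : one_line (1%g : 'S_n) = iota 1 n.
  rewrite -[1]addn0 iotaDl -val_enum_ord -map_comp.
  by apply: eq_map => i; rewrite perm1.
apply/eqP/idP => [->|t_sorted]; first exact: iota_ltn_sorted.
apply: (irr_sorted_eq ltn_trans ltnn) => //; first exact: iota_ltn_sorted.
exact: perm_mem.
Qed.

Theorem mainTheorem3 (n : nat) (n_gt0 : 0 < n) :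
  #|Sort132 n| = \sum_(0 <= k < n) 'C(n.-1, k) * catalan k.
Proof.
case: n n_gt0 => // k _; rewrite big_mkord.
rewrite -[RHS]/(binCatalan k) -tree_count_binCatalan.
have good1 := good_seq1 1.
rewrite -(descendants_tree_count k (perm_refl _) good1 (label_seq1 1)) -size_sortable_perms.
rewrite cardE -(size_map (@one_line k.+1)); apply/perm_size/uniq_perm.
- by rewrite map_inj_uniq ?enum_uniq //; apply: one_line_inj.
- exact: uniq_sortable_perms.
move=> s; rewrite mem_sortable_perms; apply/mapP/andP => [[p]|[perm_s sort_s]].
  by rewrite mem_enum inE sortable132E => sort_p ->; rewrite one_line_perm.
have [p def_s] := one_line_surj perm_s.
by exists p; rewrite ?mem_enum ?inE ?sortable132E def_s.
Qed.
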